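(* Let $G=(V,w)$ be a finite metric space and consider input sequences of TSP with time windows and service time whose minimum laxity $L$ satisfies $L>10\,\mathrm{TSP}(G)$. Then the online algorithm TSP-EDF (described in the context) has competitive ratio $1+O\big(\sqrt{\mathrm{TSP}(G)/L}\big)$.
   Context: TSP with time windows and service time: we are given a finite metric space $G=(V,w)$ and an online sequence $\sigma$ of requests; request $i$ is a pair $([r_i,d_i],v_i)$ with $r_i,d_i$ positive integers and $v_i\in V$, revealed at time $r_i$. A single server moves in $G$; traveling from $u$ to $v$ takes $w(u,v)$ time units, and serving a request requires the server to be at the request's node for one unit of time. A request counts as served only if its service takes place within $[r_i,d_i]$. The goal is to maximize the number of served requests; $\mathrm{ALG}(\sigma)$, $\mathrm{OPT}(\sigma)$ are the numbers served by the online algorithm and by an optimal offline schedule, and the competitive ratio is $\sup_\sigma\mathrm{OPT}(\sigma)/\mathrm{ALG}(\sigma)$. The minimum laxity is $L=\min_i(d_i-r_i)$. $\mathrm{TSP}(G)$ is the minimum total weight of a closed tour visiting all nodes of $G$. Algorithm TSP-EDF: let $K=\sqrt{\mathrm{TSP}(G)\,L}$ and fix the cyclic order $v_{i_1},\dots,v_{i_n}$ of the nodes given by a minimum-weight TSP tour of $G$. In each phase $\ell=1,2,\dots$: at time $K(\ell-1)$, replace the deadline $d$ of every unserved request by $K\lfloor d/K\rfloor$; let $R^\ell$ be the set of unserved requests released so far whose modified deadline has not passed; let $S^\ell$ be the set of requests in the first $K$ slots of an earliest-deadline-first schedule (by modified deadlines) of $R^\ell$, and $S^\ell_j\subseteq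 S^\ell$ those at node $v_j$. The schedule $\rho_\ell$ serves all requests of $S^\ell_{i_1}$ consecutively, then travels to $v_{i_2}$ and serves all of $S^\ell_{i_2}$, and so on in tour order. Between times $K(\ell-1)$ and $K\ell$ the requests are served according to $\rho_\ell$; whatever is not completed by time $K\ell$ is dropped from this phase.
   Formalization: The formal theorem additionally assumes TSP(G) ≥ 1 (tour at least one service time long); otherwise K = sqrt(TSP(G)·L) can be 0 or below 1, e.g. TSP(G) = 0.002, L = 1, where TSP-EDF serves nothing and the ratio is infinite. *)

(* Defs.v *)
From HB Require Import structures.
From mathcomp Require Export all_boot all_order all_algebra.
From mathcomp Require Export boolp classical_sets reals constructive_ereal ereal.

Set Implicit Arguments.
Unset Strict Implicit.
Unset Printing Implicit Defensive.
Import Order.TTheory GRing.Theory Num.Theory.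
Local Open Scope ring_scope.

Definition is_metric (R : realType) (V : finType) (w : V -> V -> R) : Prop :=
  [/\ forall x y, 0 <= w x y,
      forall x y, w x y = 0 <-> x = y,
      forall x y, w x y = w y x
    & forall x y z, w x z <= w x y + w y z].

(* A tour is a cyclic order of the nodes; [next] closes it up. *)
Definition is_tour (V : finType) (s : seq V) : bool := perm_eq s (enum V).

Definition tour_weight (R : realType) (V : finType) (w : V -> V -> R)
  (s : seq V) : R := \sum_(x <- s) w x (next s x).

(* The default value of the minimum is the weight of a tour, so it never
   lowers the minimum. *)
Definition TSP (R : realType) (V : finType) (w : V -> V -> R) : R :=
  \big[Num.min/tour_weight w (enum V)]_(s : #|V|.-tuple V | is_tour s)
    tour_weight w s.

(* The request ([r, d], v) is the triple (r, d, v). *)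
Notation request V := (nat * nat * V)%type.

(* A request together with its position in the input sequence, which keeps
   apart equal requests of the same sequence. *)
Notation job V := (nat * (nat * nat * V))%type.

Definition release (V : finType) (j : job V) : nat := j.2.1.1.
Definition deadline (V : finType) (j : job V) : nat := j.2.1.2.
Definition node (V : finType) (j : job V) : V := j.2.2.

Definition jobs (V : finType) (sigma : seq (request V)) : seq (job V) :=
  zip (iota 0 (size sigma)) sigma.

Definition valid_input (V : finType) (sigma : seq (request V)) : Prop :=
  forall j, j \in jobs sigma -> (0 < release j <= deadline j)%N.

(* The subtraction is not truncated on valid inputs. *)
Definition laxity (V : finType) (j : job V) : nat :=
  (deadline j - release j)%N.

(* In particular the input sequence is nonempty. *)
Definition min_laxity_is (V : finType) (L : nat) (sigma : seq (request V)) :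
    Prop :=
  (exists2 j, j \in jobs sigma & laxity j = L) /\
  (forall j, j \in jobs sigma -> (L <= laxity j)%N).

(* A service (j, t) occupies the server at node j during [t, t + 1]. *)
Definition in_window (R : realType) (V : finType) (p : job V * R) : bool :=
  ((release p.1)%:R <= p.2) && (p.2 + 1 <= (deadline p.1)%:R).

(* An offline schedule is the chronological list of its services; the server
   may start at any node. *)
Definition feasible (R : realType) (V : finType) (w : V -> V -> R)
    (sigma : seq (request V)) (s : seq (job V * R)) : Prop :=
  [/\ uniq [seq p.1 | p <- s],
      {subset [seq p.1 | p <- s] <= jobs sigma},
      all (@in_window R V) s
    & sorted (fun p q => p.2 + 1 + w (node p.1) (node q.1) <= q.2) s].

Definition OPT (R : realType) (V : finType) (w : V -> V -> R)
    (sigma : seq (request V)) : nat :=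
  \max_(k < (size sigma).+1 | `[< exists2 s, feasible w sigma s & size s = k >])
    k.

Definition phase_length (R : realType) (V : finType) (w : V -> V -> R)
  (L : nat) : R := Num.sqrt (TSP w * L%:R).

(* Rounding is idempotent, so rounding again in each phase changes nothing. *)
Definition mod_deadline (R : realType) (V : finType) (K : R) (j : job V) : R :=
  K * (Num.floor ((deadline j)%:R / K))%:~R.

(* What the description of TSP-EDF leaves open: which minimum-weight tour is
   used and from which node it is read, how equal modified deadlines are
   ordered, in which order the requests chosen at one node are served, and
   where the server is at time 0.  The two orders only see the jobs to be
   ordered, hence no future request. *)
Record edf_choices (R : realType) (V : finType) (w : V -> V -> R) (L : nat) :=
  EdfChoices {
    tsp_tour : seq V;
    edf_order : seq (job V) -> seq (job V);
    node_order : seq (job V) -> seq (job V);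
    start_node : V;
    tsp_tourP : is_tour tsp_tour /\ tour_weight w tsp_tour = TSP w;
    edf_orderP : forall s, perm_eq (edf_order s) s /\
      sorted (fun i j => mod_deadline (phase_length w L) i
                         <= mod_deadline (phase_length w L) j) (edf_order s);
    node_orderP : forall s, perm_eq (node_order s) s
  }.

(* The requests that can still be served at time t: released, not yet served,
   and with modified deadline after t. *)
Definition pending (R : realType) (V : finType) (K : R)
    (sigma : seq (request V)) (served : seq (job V)) (t : R) : seq (job V) :=
  [seq j <- jobs sigma | [&& j \notin served, (release j)%:R <= t
                           & t < mod_deadline K j]].

(* The plan of a phase: [inl v] moves the server to v, [inr j] serves j. *)
Definition plan (V : finType) (tour : seq V)
    (ord : seq (job V) -> seq (job V)) (S : seq (job V)) : seq (V + job V) :=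
  flatten [seq inl v :: [seq inr j | j <- ord [seq j <- S | node j == v]]
          | v <- tour].

(* Executes a plan from node x at time t, up to the first move or service that
   cannot be completed by time [stop]; the server then waits where it is.
   Returns the final node and the services made. *)
Fixpoint execute (R : realType) (V : finType) (w : V -> V -> R) (stop : R)
    (x : V) (t : R) (rho : seq (V + job V)) : V * seq (job V * R) :=
  match rho with
  | [::] => (x, [::])
  | inl v :: rho' =>
      if t + w x v <= stop then execute w stop v (t + w x v) rho'
      else (x, [::])
  | inr j :: rho' =>
      if t + 1 <= stop then
        let r := execute w stop x (t + 1) rho' in (r.1, (j, t) :: r.2)
      else (x, [::])
  end.

(* The position of the server at time K * l, and all its services until then.
   All pending modified deadlines are at least one phase away, so the first K
   (that is, the first floor K) unit slots of an earliest-deadline-first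
   schedule hold the first floor K pending requests. *)
Fixpoint tsp_edf_run (R : realType) (V : finType) (w : V -> V -> R) (L : nat)
    (c : edf_choices w L) (sigma : seq (request V)) (l : nat) :
    V * seq (job V * R) :=
  match l with
  | 0%N => (start_node c, [::])
  | l'.+1 =>
      let K := phase_length w L in
      let st := tsp_edf_run c sigma l' in
      let t := K * l'%:R in
      let pool := pending K sigma [seq p.1 | p <- st.2] t in
      let S := take (Num.truncn K) (edf_order c pool) in
      let rho := plan (tsp_tour c) (node_order c) S in
      let r := execute w (K * l'.+1%:R) st.1 t rho in
      (r.1, st.2 ++ r.2)
  end.

Definition tsp_edf (R : realType) (V : finType) (w : V -> V -> R) (L : nat)
    (c : edf_choices w L) (sigma : seq (request V)) : nat :=
  count (fun j => `[< exists l p, [/\ p \in (tsp_edf_run c sigma l).2,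
                                      p.1 = j & in_window p] >])
        (jobs sigma).

(* In \bar R the inverse of 0 is +oo, so an input on which the algorithm serves
   nothing and OPT is positive makes the ratio +oo. *)
Definition competitive_ratio (R : realType) (V : finType) (w : V -> V -> R)
    (L : nat) (ALG : seq (request V) -> nat) : \bar R :=
  ereal_sup [set (((OPT w sigma)%:R)%:E / ((ALG sigma)%:R)%:E)%E
            | sigma in [set sigma | valid_input sigma
                                    /\ min_laxity_is L sigma]].

(* Main.v *)
(* Rounding windows to multiples of K costs a request at most two phases, and
   travel costs a phase at most 2 TSP + 1 of its K slots.  Let D be the deadline
   (in phases) of a lost request, and look back from D to the last phase that
   did not serve a full load m >= K - 2 TSP - 1 of requests due by D.  By EDF,
   that phase leaves at most floor(K) - m of the requests due by D.  All other
   requests due by D that can be lost have their whole window in the following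
   H full phases: if one of them is lost then H + 2 >= L / K, so the at most
   K (H + 2) slots of OPT exceed the m H services by O(K / L + TSP / K) m H
   only; if none is lost, the loss floor(K) - m is charged to the full phase
   just before D.  With K^2 = TSP * L both relative errors are
   O(sqrt (TSP / L)), and induction on D adds them up. *)
Require Import Defs.
From mathcomp Require Import zify lra ring.
Import Order.TTheory GRing.Theory Num.Theory.
Local Open Scope ring_scope.
Set Implicit Arguments.
Unset Strict Implicit.
Unset Printing Implicit Defensive.

(** * Counting, and looking back along the phases *)

Lemma count_uniq_leqD (T : eqType) (P Q1 Q2 : pred T) (X Y Z : seq T) :
  uniq X ->
  (forall x, x \in X -> P x -> (x \in Y) && Q1 x || (x \in Z) && Q2 x) ->
  (count P X <= count Q1 Y + count Q2 Z)%N.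
Proof.
move=> uX sub; rewrite -!size_filter -size_cat; apply: uniq_leq_size.
  exact: filter_uniq.
move=> x; rewrite mem_filter => /andP[Px xX].
by rewrite mem_cat !mem_filter (andbC (Q1 x)) (andbC (Q2 x)) sub.
Qed.

(** The look back from a due phase D: s starts the longest run of phases before D that satisfy
    [P]. *)
Lemma last_failure (P : nat -> Prop) (D : nat) :
  exists2 s, (s <= D)%N &
    (forall l, (s <= l < D)%N -> P l) /\ (s = 0 \/ 0 < s /\ ~ P s.-1)%N.
Proof.
elim: D => [|D [s sD [Ps s0]]]; first by exists 0%N => //; split=> [l|]; [lia | left].
have [PD|nPD] := pselect (P D); last first.
  by exists D.+1 => //; split=> [l|]; [lia | right].
exists s; first lia.
split=> // l sl; have [->//|lD] := eqVneq l D; apply: Ps; lia.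
Qed.

(** * Competitiveness of an abstract phase schedule *)

Section PhaseScheduling.
(** [Js] stands for the jobs, [X] for those of an optimal schedule, [rel j l] for release by the
    start of phase l, [new l] for the services of phase l, [srv l] for those before it, [m] for a
    full load and [k] for the excess of a selection over a full load. *)
Variables (R : realType) (T : eqType) (Js X : seq T) (b : T -> nat).
Variables (rel : T -> nat -> bool) (new srv : nat -> seq T) (m k : nat).
Variable delta : R.

(* [b j] is the phase before which j is due.  A late request misses the start of
   phase s - 1, so that it cannot belong to the backlog of that phase. *)
Let late s j := ~~ ((0 < s)%N && rel j s.-1).

Hypothesis srv0 : srv 0 = [::].
Hypothesis srvS : forall l, srv l.+1 = srv l ++ new l.
Hypothesis srv_uniq : forall l, uniq (srv l).
Hypothesis new_job : forall l, {subset new l <= Js}.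
Hypothesis new_due : forall l j, j \in new l -> (l < b j)%N.
Hypothesis busy_or_few_left : forall l D,
  (m <= count (fun j => b j <= D) (new l) \/
   count (fun j => [&& rel j l, l < b j <= D & j \notin srv l.+1]) Js <= k)%N.
Hypothesis left_busy : forall l j, j \in Js -> rel j l -> (l < b j)%N ->
  j \notin srv l.+1 -> (m <= size (new l))%N.
Hypothesis X_uniq : uniq X.
Hypothesis X_job : {subset X <= Js}.
Hypothesis last_rel : forall j, j \in Js -> (0 < b j)%N && rel j (b j).-1.
Hypothesis delta_ge0 : 0 <= delta.
Hypothesis carry_small : k%:R <= delta * m%:R.
(** [k] enters twice: for carried requests that are lost, and for services of the stretch spent on
    carried requests. *)
Hypothesis stretch_bound : forall s D j, (s <= D)%N -> j \in Js -> late s j ->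
  (b j <= D)%N ->
  (count (fun j => late s j && (b j <= D)%N) X + k.*2)%:R
    <= (1 + delta) * (m * (D - s))%:R.

Lemma srv_cat s h : srv (s + h) = srv s ++ flatten [seq new l | l <- iota s h].
Proof.
elim: h s => [|h IH] s; first by rewrite addn0 cats0.
by rewrite addnS -addSn IH srvS /= catA.
Qed.

Lemma srv_sub s t : (s <= t)%N -> {subset srv s <= srv t}.
Proof. by move=> st j js; rewrite -(subnKC st) srv_cat mem_cat js. Qed.

Lemma size_srv_le s t : (s <= t)%N -> (size (srv s) <= size (srv t))%N.
Proof. by move=> st; rewrite -(subnKC st) srv_cat size_cat leq_addr. Qed.

Lemma srv_due t j : j \in srv t -> j \in Js.
Proof.
elim: t => [|t IH]; first by rewrite srv0.
by rewrite srvS mem_cat => /orP[/IH|/new_job].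
Qed.

Lemma stretch_count D s h :
  (forall l, (s <= l < s + h)%N -> m <= count (fun j => b j <= D) (new l))%N ->
  (m * h <= count (fun j => b j <= D) (flatten [seq new l | l <- iota s h]))%N.
Proof.
elim: h s => [|h IH] s busy; first by rewrite muln0.
rewrite /= count_cat mulnS leq_add ?busy ?IH //; first lia.
by move=> l ?; apply: busy; lia.
Qed.

Lemma stretch_new s h j :
  j \in flatten [seq new l | l <- iota s h] -> (s < b j)%N.
Proof.
move=> /flatten_mapP[l]; rewrite mem_iota => sl /new_due; lia.
Qed.

(** Each service pays [delta] at most once. As the error term stops at [srv n.-1], phase D - 1 has
    not paid yet when the induction hypothesis is used at some s <= D, even for s = D. *)
Lemma phase_induction N n : (n <= N)%N ->
  (count (fun j => b j < n)%N X)%:R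
    <= (count (fun j => b j < n)%N (srv N))%:R
       + delta * (size (srv n.-1))%:R :> R.
Proof.
elim/ltn_ind: n => -[_ _|D IH DN].
  have -> : count (fun j => b j < 0)%N X = 0%N by elim: (X) => //= *; lia.
  by rewrite addr_ge0 ?mulr_ge0.
have cntS Y : count (fun j => b j < D.+1)%N Y
    = (count (fun j => b j < D)%N Y + count (fun j => b j == D) Y)%N.
  by elim: Y => //= j Y ->; lia.
(* If every request of [X] due at D is eventually served, the hypothesis at D suffices. *)
have [lost|/hasPn nolost] :=
  boolP (has (fun j => (b j == D) && (j \notin srv N)) X); last first.
  have {}IH := IH D (ltnSn _) (ltnW DN).
  have cD : (count (fun j => b j == D) X <= count (fun j => b j == D) (srv N))%N.
    rewrite -[leqRHS]addn0 -(count_pred0 ([::] : seq T)).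
    apply: count_uniq_leqD => // j jX bD.
    by have := nolost j jX; rewrite bD /= orbF negbK => ->.
  rewrite !cntS !natrD /=; move: cD; rewrite -(ler_nat R) => cD.
  have : delta * (size (srv D.-1))%:R <= delta * (size (srv D))%:R.
    by rewrite ler_wpM2l // ler_nat size_srv_le // leq_pred.
  lra.
move: lost => /hasP[j0 j0X /andP[/eqP b0 j0N]].
have j0J := X_job j0X.
have DN' := ltnW DN.
have /andP[D_gt0 rel0] := last_rel j0J; rewrite b0 in D_gt0 rel0.
(* The lost request was still pending in phase D - 1, so that phase makes [m] services, though
   perhaps not all due by D. *)
have sizeD : (size (srv D.-1) + m <= size (srv D))%N.
  rewrite -[in leqRHS](prednK D_gt0) srvS size_cat leq_add2l.
  apply: (@left_busy _ j0); rewrite ?b0 //; first lia.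
  by apply: contra j0N; apply: srv_sub; rewrite prednK.
have [s sD [busy stop]] :=
  last_failure (fun l => m <= count (fun j => b j <= D) (new l))%N D.
have {}IH := IH s sD (leq_trans sD DN').
(* The [old] requests were released by the start of phase s - 1, which is not busy, so
   [busy_or_few_left] bounds those it leaves. For s = 0 every request is late and none is old. *)
pose old j := (s <= b j <= D)%N && ~~ late s j.
pose fresh j := (s <= b j <= D)%N && late s j.
pose carry j := old j && (j \notin srv s).
have carry_k : (count carry Js <= k)%N.
  case: stop => [s0|[s_gt0 nbusy]].
    rewrite (eq_count (a2 := pred0)) ?count_pred0 // => j.
    by rewrite /carry /old /late s0 /= andbF.
  have [//|] := busy_or_few_left s.-1 D.
  rewrite prednK //; apply: leq_trans; apply: sub_count => j.
  rewrite /carry /old /late negbK s_gt0 /= => /andP[/andP[-> ->] ->].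
  lia.
have split3 Y : count (fun j => b j < D.+1)%N Y
    = (count (fun j => b j < s)%N Y + count old Y + count fresh Y)%N.
  rewrite /old /fresh; elim: Y => //= j Y ->.
  case: (late s j); rewrite /= ?andbT ?andbF; lia.
have sN : {subset srv s <= srv N} := srv_sub (leq_trans sD DN').
have cO : (count old X <= count old (srv N) + k)%N.
  apply: leq_trans (leq_add (leqnn _) carry_k).
  apply: count_uniq_leqD => // j jX oj; rewrite oj andbT X_job //= /carry oj /=.
  by case: (boolP (j \in srv s)) => [/sN->|]; rewrite ?orbT.
have dmono : delta * (size (srv s.-1))%:R <= delta * (size (srv D.-1))%:R.
  by rewrite ler_wpM2l // ler_nat size_srv_le // -!subn1 leq_sub2r.
rewrite !split3 !natrD /=.
(* If a fresh request is lost, [stretch_bound] applies and the phases from s to D - 1 pay. *)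
have [|/hasPn nolost] := boolP (has (fun j => fresh j && (j \notin srv N)) X).
  case/hasP => j1 j1X /andP[/andP[/andP[_ b1D] late1] _].
  have := stretch_bound sD (X_job j1X) late1 b1D.
  have cX : (count fresh X <= count (fun j => late s j && (b j <= D)%N) X)%N.
    by apply: sub_count => j /andP[/andP[_ ->] ->].
  have sDh : (s + (D - s))%N = D by rewrite subnKC.
  have cF := @stretch_count D s (D - s).
  rewrite sDh in cF; move/(_ busy) in cF.
  have := srv_cat s (D - s); rewrite sDh => srvD.
  (* A service of the stretch due by D is fresh, or else old and, as nothing is served twice,
     unserved at s. *)
  have cF2 : (count (fun j => b j <= D)%N
                (flatten [seq new l | l <- iota s (D - s)])
             <= count fresh (srv N) + count carry Js)%N.
    have := srv_uniq D; rewrite srvD cat_uniq => /and3P[_ /hasPn disj uF].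
    apply: count_uniq_leqD => // j jF bjD.
    have jD : j \in srv D by rewrite srvD mem_cat jF orbT.
    have -> : j \in srv N by apply: srv_sub jD.
    rewrite (srv_due jD) /carry /fresh /old bjD (disj _ jF).
    by have /ltnW-> := stretch_new jF; case: (late s j).
  have sz : (size (srv s.-1) + m * (D - s) <= size (srv D))%N.
    rewrite srvD size_cat leq_add ?size_srv_le ?leq_pred //.
    by apply: leq_trans cF _; apply: count_size.
  move: (leq_trans cF (leq_trans cF2 (leq_add (leqnn _) carry_k))) cO cX sz.
  rewrite -addnn -!(ler_nat R) !natrD => cF3 cO cX sz sb.
  have : delta * ((size (srv s.-1))%:R + (m * (D - s))%:R)
      <= delta * (size (srv D))%:R.
    by rewrite ler_wpM2l.
  lra.
(* Now only carried requests are lost, at most [k] of them, and phase D - 1 alone pays by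
   [carry_small]. *)
have cJ : (count fresh X <= count fresh (srv N))%N.
  rewrite -[leqRHS]addn0 -(count_pred0 ([::] : seq T)).
  apply: count_uniq_leqD => // j jX fj.
  by have := nolost j jX; rewrite fj /= orbF negbK => ->.
move: (carry_small) cO cJ sizeD; rewrite -!(ler_nat R) !natrD => ck cO cJ sz.
have : delta * ((size (srv D.-1))%:R + m%:R) <= delta * (size (srv D))%:R.
  by rewrite ler_wpM2l.
lra.
Qed.

Lemma phase_competitive : exists N,
  (size X)%:R <= (1 + delta) * (size (srv N))%:R :> R.
Proof.
pose N := (\max_(j <- X) b j).+1; exists N.
have := @phase_induction N N (leqnn _).
have -> : count (fun j => b j < N)%N X = size X.
  apply/eqP; rewrite -all_count; apply/allP => j jX.
  by rewrite ltnS; apply: leq_bigmax_seq.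
have : (count (fun j => b j < N)%N (srv N))%:R <= (size (srv N))%:R :> R.
  by rewrite ler_nat count_size.
have : delta * (size (srv N.-1))%:R <= delta * (size (srv N))%:R.
  by rewrite ler_wpM2l // ler_nat size_srv_le.
lra.
Qed.

End PhaseScheduling.

(** * Walks and tours in a metric space *)

Fixpoint walk (R : realType) (V : finType) (w : V -> V -> R) (x : V)
    (p : seq V) : R :=
  if p is y :: p' then w x y + walk w y p' else 0.

Section Metric.
Variables (R : realType) (V : finType) (w : V -> V -> R).
Hypothesis w_metric : is_metric w.

Lemma w_ge0 x y : 0 <= w x y.
Proof. by case: w_metric. Qed.

Lemma w_triangle x y z : w x z <= w x y + w y z.
Proof. by case: w_metric. Qed.

Lemma w_refl x : w x x = 0.
Proof. by case: w_metric => _ w0 _ _; apply/w0. Qed.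

Lemma walk_ge0 x p : 0 <= walk w x p.
Proof. by elim: p x => //= y p IH x; rewrite addr_ge0 ?w_ge0. Qed.

Lemma walk_cat x p q : walk w x (p ++ q) = walk w x p + walk w (last x p) q.
Proof. by elim: p x => [|y p IH] x /=; rewrite ?add0r // IH addrA. Qed.

Lemma dist_le_walk x p : w x (last x p) <= walk w x p.
Proof.
elim: p x => [|y p IH] x /=; first by rewrite w_refl.
by apply: le_trans (w_triangle x y _) _; rewrite lerD2l.
Qed.

Lemma tour_weight_cons x p : uniq (x :: p) ->
  tour_weight w (x :: p) = walk w x (rcons p x).
Proof.
rewrite /tour_weight /=.
(* The node to return to is generalized, since it stays fixed while the start moves along the
   list. *)
suff gen y : uniq (x :: p) ->
    \sum_(z <- x :: p) w z (next_at z y x p) = walk w x (rcons p y) by apply: gen.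
elim: p x => [|x' p IH] x; first by rewrite /= big_seq1 eqxx addr0.
move=> /andP[xp up]; rewrite big_cons /= eqxx -IH //; congr (_ + _).
rewrite big_seq [RHS]big_seq; apply: eq_bigr => z zp.
by case: eqP => // zx; rewrite -zx zp in xp.
Qed.

Lemma tour_weight_rot n s : uniq s -> tour_weight w (rot n s) = tour_weight w s.
Proof.
move=> us; rewrite /tour_weight (perm_big s) ?perm_rot //=.
by apply: eq_bigr => x _; rewrite next_rot.
Qed.

Lemma tour_uniq s : @is_tour V s -> uniq s.
Proof. by move=> /perm_uniq->; apply: enum_uniq. Qed.

Lemma mem_tour s x : @is_tour V s -> x \in s.
Proof. by move=> /perm_mem->; rewrite mem_enum. Qed.

(** Rotated to start at x, the tour passes through y, and its part up to y is at least the
    distance. *)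
Lemma dist_le_tour s x y : is_tour s -> w x y <= tour_weight w s.
Proof.
move=> ts; have us := tour_uniq ts.
have [i p def_s] := rot_to (mem_tour x ts).
have up : uniq (x :: p) by rewrite -def_s rot_uniq.
have : y \in x :: p by rewrite -def_s mem_rot mem_tour.
rewrite -(tour_weight_rot i us) def_s tour_weight_cons //.
case/splitPl=> p1 p2 <-; rewrite rcons_cat walk_cat.
by rewrite (le_trans (dist_le_walk _ _)) // lerDl walk_ge0.
Qed.

(** One tour weight pays for reaching the first node of the tour, the other for following it. *)
Lemma walk_tour x s : is_tour s -> walk w x s <= 2 * tour_weight w s.
Proof.
move=> ts; have us := tour_uniq ts.
case: s => [|v p] in ts us *; first by have := mem_tour x ts.
rewrite mulr2n mulrDl mul1r /= lerD ?dist_le_tour //.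
by rewrite tour_weight_cons // -cats1 walk_cat lerDl walk_ge0.
Qed.

End Metric.

(** * Plans and their execution *)

Definition moves (V : finType) (rho : seq (V + job V)) : seq V :=
  pmap (fun o => if o is inl v then Some v else None) rho.

Definition services (V : finType) (rho : seq (V + job V)) : seq (job V) :=
  pmap (fun o => if o is inr j then Some j else None) rho.

Section Execution.
Variables (R : realType) (V : finType) (w : V -> V -> R).
Hypothesis w_metric : is_metric w.

Lemma execute_services stop x t rho :
  [seq p.1 | p <- (execute w stop x t rho).2]
    = take (size (execute w stop x t rho).2) (services rho).
Proof.
elim: rho x t => [|[v|j] rho IH] x t //=.
  by case: ifP => //= _; rewrite take0.
by case: ifP => //= _; rewrite ?take0 // -IH.
Qed.

Lemma execute_times stop x t rho p : p \in (execute w stop x t rho).2 ->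
  t <= p.2 /\ p.2 + 1 <= stop.
Proof.
elim: rho x t => [|[v|j] rho IH] x t //=; case: ifP => //= tstop.
  by case/IH => le_t ?; split=> //; have := w_ge0 w_metric x v; lra.
by rewrite inE => /predU1P[->|/IH[]] //=; split=> //; lra.
Qed.

(** If all the travel and n services fit before [stop], no step up to the n-th service is
    refused. *)
Lemma execute_size stop x t rho n : t + walk w x (moves rho) + n%:R <= stop ->
  (minn (size (services rho)) n <= size (execute w stop x t rho).2)%N.
Proof.
elim: rho x t n => [|[v|j] rho IH] x t n //=; first by rewrite min0n.
  move=> le_stop; rewrite ifT; first by apply: IH; rewrite addrA in le_stop.
  by have := walk_ge0 w_metric v (moves rho); have := ler0n R n; lra.
case: n => [|n]; first by rewrite minn0.
rewrite -addn1 natrD => le_stop; rewrite ifT; last first.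
  by have := walk_ge0 w_metric x (moves rho); have := ler0n R n; lra.
by rewrite addn1 minnSS ltnS; apply: IH; rewrite -/(moves rho) in le_stop; lra.
Qed.

End Execution.

Section Plan.
Variables (V : finType) (tour : seq V) (ord : seq (job V) -> seq (job V)).

Lemma moves_plan S : moves (plan tour ord S) = tour.
Proof.
rewrite /plan /moves; elim: tour => //= v s IH; rewrite pmap_cat IH.
by elim: (ord _).
Qed.

Lemma services_plan S : services (plan tour ord S)
  = flatten [seq ord [seq j <- S | node j == v] | v <- tour].
Proof.
rewrite /plan /services; elim: tour => //= v s IH; rewrite pmap_cat IH.
by congr (_ ++ _); elim: (ord _) => //= j q ->.
Qed.

Lemma perm_services_plan S : is_tour tour -> (forall s, perm_eq (ord s) s) ->
  perm_eq (services (plan tour ord S)) S.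
Proof.
move=> ts ordP; apply/permP => a; rewrite services_plan.
(* The tour lists each node once, so each job is counted in the block of its own node only. *)
have -> : count a (flatten [seq ord [seq j <- S | node j == v] | v <- tour])
    = (\sum_(v : V) count a [seq j <- S | node j == v])%N.
  rewrite -big_enum -(perm_big _ ts) /=.
  elim: (tour) => [|v s IH]; first by rewrite big_nil.
  by rewrite big_cons /= count_cat IH (permP (ordP _)).
elim: S => [|j S IH] /=; first by rewrite big1.
rewrite -IH (eq_bigr (fun v => ((v == node j) * a j)%N
    + count a [seq j <- S | node j == v])%N).
  rewrite big_split /= -big_distrl /= (bigD1 (node j)) //= eqxx big1 ?mul1n //.
  by move=> v /negbTE->.
by move=> v _; rewrite (eq_sym v); case: eqP => _ /=; rewrite ?mul1n ?mul0n.
Qed.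

End Plan.

(** * Time slots of an offline schedule *)

Section Slots.
Variables (R : realType) (V : finType) (w : V -> V -> R).
Hypothesis w_metric : is_metric w.

Lemma feasible_slots sigma (s : seq (job V * R)) (P : pred (job V)) (x y : R) :
  feasible w sigma s -> x <= y ->
  (forall j, j \in jobs sigma -> P j ->
     x <= (release j)%:R /\ (deadline j)%:R <= y) ->
  (count P [seq p.1 | p <- s])%:R <= y - x.
Proof.
move=> [_ sub inw srt] xy Pxy.
(* Nonnegative travel times are dropped; what remains says that the services are disjoint unit
   intervals. *)
pose before (p q : job V * R) := p.2 + 1 <= q.2.
have trb : transitive before by rewrite /before => q p r /=; lra.
have {}srt : sorted before s.
  apply: sub_sorted srt => p q; have := w_ge0 w_metric (node p.1) (node q.1).
  by rewrite /before; lra.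
rewrite count_map -size_filter.
have : {in [seq p <- s | P p.1], forall p, x <= p.2 /\ p.2 + 1 <= y}.
  move=> p; rewrite mem_filter => /andP[Pp ps].
  have [||rx dy] := Pxy p.1 => //; first by apply/sub/map_f.
  by have /andP[] := allP inw _ ps; lra.
have := sorted_filter trb (fun p => P p.1) srt.
case: [seq p <- s | P p.1] => [|p q] /= srt' wnd; first by lra.
have [xp py] := wnd p (mem_head _ _).
suff : p.2 + 1 + (size q)%:R <= y by rewrite -addn1 natrD; lra.
have {}wnd : {in q, forall p, p.2 + 1 <= y}.
  by move=> r rq; have [|//] := wnd r; rewrite inE rq orbT.
elim: q p srt' wnd {xp} py => [|r q IH] p /= srt' wnd py; first by lra.
have /andP[pr rq] := srt'.
have wndq : {in q, forall z, z.2 + 1 <= y}.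
  by move=> z zq; apply: wnd; rewrite inE zq orbT.
have := IH r rq wndq (wnd r (mem_head _ _)).
rewrite /before in pr; rewrite -addn1 natrD; lra.
Qed.

End Slots.

(** * The run of TSP-EDF, phase by phase *)

Lemma jobs_uniq (V : finType) (sigma : seq (request V)) : uniq (jobs sigma).
Proof.
apply: (@map_uniq _ _ fst); rewrite -/(unzip1 _) unzip1_zip ?iota_uniq //.
by rewrite size_iota.
Qed.

Lemma sorted_take_drop (T : eqType) (e : rel T) n (s : seq T) x y :
  transitive e -> sorted e s -> x \in take n s -> y \in drop n s -> e x y.
Proof.
move=> e_tr; rewrite -{1}(cat_take_drop n s) (sorted_pairwise e_tr).
by rewrite pairwise_cat => /and3P[/allrelP es _ _] xs ys; apply: es.
Qed.

Section Run.
Variables (R : realType) (V : finType) (w : V -> V -> R) (L : nat).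
Variables (c : edf_choices w L) (sigma : seq (request V)).
Hypothesis w_metric : is_metric w.

Let K := phase_length w L.
Hypothesis K_gt0 : 0 < K.

(** The modified deadline in units of [K], as a natural number comparable with phase indices. *)
Definition due_phase (j : job V) : nat := Num.truncn ((deadline j)%:R / K).

Lemma mod_deadlineE j : mod_deadline K j = K * (due_phase j)%:R.
Proof.
have dK : 0 <= (deadline j)%:R / K by rewrite divr_ge0 // ltW.
rewrite /mod_deadline /due_phase truncn_floor dK natr_absz ger0_norm //.
by rewrite floor_ge0.
Qed.

Lemma mod_deadline_le_deadline (j : job V) : mod_deadline K j <= (deadline j)%:R.
Proof.
by rewrite mod_deadlineE mulrC -ler_pdivlMr // truncn_le divr_ge0 // ltW.
Qed.

Lemma deadline_lt_due_phase j : (deadline j)%:R < K * (due_phase j).+1%:R.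
Proof. by rewrite mulrC -ltr_pdivrMr // truncnS_gt. Qed.

Lemma le_due_phase n j : (n <= due_phase j)%N = (K * n%:R <= (deadline j)%:R).
Proof.
by rewrite truncn_ge_nat ?divr_ge0 ?(ltW K_gt0) // ler_pdivlMr // mulrC.
Qed.

Definition served l := [seq p.1 | p <- (tsp_edf_run c sigma l).2].
Definition released (j : job V) (l : nat) : bool := (release j)%:R <= K * l%:R.
Definition pool l := pending K sigma (served l) (K * l%:R).
Definition selected l := take (Num.truncn K) (edf_order c (pool l)).
Definition phase_services l :=
  (execute w (K * l.+1%:R) (tsp_edf_run c sigma l).1 (K * l%:R)
     (plan (tsp_tour c) (node_order c) (selected l))).2.
Definition newly_served l := [seq p.1 | p <- phase_services l].

Lemma servedS l : served l.+1 = served l ++ newly_served l.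
Proof. by rewrite /served /= map_cat. Qed.

Lemma mem_pool l j : (j \in pool l)
  = [&& j \in jobs sigma, j \notin served l, released j l & (l < due_phase j)%N].
Proof.
rewrite mem_filter andbC mod_deadlineE ltr_pM2l // ltr_nat.
by rewrite -/(served l).
Qed.

Lemma perm_edf_order l : perm_eq (edf_order c (pool l)) (pool l).
Proof. by case: (edf_orderP c (pool l)). Qed.

Lemma edf_order_uniq l : uniq (edf_order c (pool l)).
Proof. by rewrite (perm_uniq (perm_edf_order l)) filter_uniq // jobs_uniq. Qed.

Lemma selected_pool l : {subset selected l <= pool l}.
Proof. by move=> j /mem_take; rewrite (perm_mem (perm_edf_order l)). Qed.

Lemma perm_planned l :
  perm_eq (services (plan (tsp_tour c) (node_order c) (selected l)))
          (selected l).
Proof.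
by apply: perm_services_plan; [case: (tsp_tourP c) | apply: node_orderP].
Qed.

Lemma newly_served_planned l : newly_served l
  = take (size (newly_served l))
      (services (plan (tsp_tour c) (node_order c) (selected l))).
Proof. by rewrite /newly_served size_map execute_services. Qed.

Lemma newly_served_selected l : {subset newly_served l <= selected l}.
Proof.
move=> j; rewrite newly_served_planned => /mem_take.
by rewrite (perm_mem (perm_planned l)).
Qed.

Lemma newly_served_uniq l : uniq (newly_served l).
Proof.
rewrite newly_served_planned take_uniq // (perm_uniq (perm_planned l)).
by rewrite take_uniq // edf_order_uniq.
Qed.

Lemma newly_served_pool l : {subset newly_served l <= pool l}.
Proof. by move=> j /newly_served_selected/selected_pool. Qed.

Lemma served_uniq l : uniq (served l).
Proof.
elim: l => // l IH; rewrite servedS cat_uniq IH newly_served_uniq andbT /=.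
apply/hasPn => j /newly_served_pool.
by rewrite mem_pool => /and4P[].
Qed.

Lemma served_job l : {subset served l <= jobs sigma}.
Proof.
elim: l => // l IH j; rewrite servedS mem_cat => /orP[/IH//|].
by move/newly_served_pool; rewrite mem_pool => /and4P[].
Qed.

(** A pending request has its modified deadline no earlier than the end of the phase, and rounding
    only lowered it. *)
Lemma run_in_window l p : p \in (tsp_edf_run c sigma l).2 -> in_window p.
Proof.
elim: l => // l IH; rewrite /= mem_cat => /orP[/IH//|]; rewrite -/K => pl.
have : p.1 \in newly_served l by apply: map_f.
move/newly_served_pool; rewrite mem_pool => /and4P[_ _ rel_p due_p].
have [t_ge t_le] := execute_times w_metric pl.
rewrite /in_window (le_trans rel_p) //=.
apply: le_trans t_le _; apply: le_trans (mod_deadline_le_deadline _).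
by rewrite mod_deadlineE ler_pM2l // ler_nat.
Qed.

Lemma size_served_le_tsp_edf l : (size (served l) <= tsp_edf c sigma)%N.
Proof.
rewrite /tsp_edf -size_filter; apply: uniq_leq_size (served_uniq l) _ => j jl.
rewrite mem_filter (served_job jl) andbT; apply/asboolP.
have /mapP[p pl ->] := jl; exists l, p; split=> //; exact: run_in_window pl.
Qed.

Section Capacity.
Variable m : nat.
Hypothesis m_bound : 2 * TSP w + m%:R <= K.

Lemma capacity_le : (m <= Num.truncn K)%N.
Proof.
rewrite truncn_ge_nat ?(ltW K_gt0) //; apply: le_trans m_bound.
rewrite lerDr mulr_ge0 //; have [tour_c <-] := tsp_tourP c.
by apply: sumr_ge0 => x _; apply: w_ge0.
Qed.

(** Travel takes at most twice the tour weight by [walk_tour], which leaves time for [m]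
    services. *)
Lemma phase_progress l :
  (minn (size (selected l)) m <= size (newly_served l))%N.
Proof.
rewrite size_map -(perm_size (perm_planned l)); apply: execute_size => //.
rewrite moves_plan -addn1 natrD mulrDr mulr1 -addrA lerD2l.
have [tour_c wT] := tsp_tourP c.
apply: le_trans m_bound; rewrite lerD2r -wT.
exact: walk_tour.
Qed.

Lemma edf_before l i j : i \in selected l -> j \in pool l ->
  j \notin selected l -> (due_phase i <= due_phase j)%N.
Proof.
move=> i_sel; rewrite -(perm_mem (perm_edf_order l)).
rewrite -{1}(cat_take_drop (Num.truncn K) (edf_order c _)) mem_cat.
rewrite -/(selected l) => /orP[->//|j_drop _].
have [_ srt] := edf_orderP c (pool l).
have := sorted_take_drop _ srt i_sel j_drop.
rewrite !mod_deadlineE ler_pM2l // ler_nat; apply.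
by move=> y x z; apply: le_trans.
Qed.

Lemma size_selected l j : j \in pool l -> j \notin selected l ->
  size (selected l) = Num.truncn K.
Proof.
rewrite -(perm_mem (perm_edf_order l)) => j_ord.
rewrite /selected size_take; case: ltnP => // le_K.
by rewrite take_oversize // j_ord.
Qed.

Lemma size_newly_served_full l j : j \in pool l -> j \notin selected l ->
  (m <= size (newly_served l))%N.
Proof.
move=> j_pool j_sel; apply: leq_trans (phase_progress l).
by rewrite (size_selected j_pool j_sel) (minn_idPr capacity_le).
Qed.

(** A request left over was either not selected, so the selection was full, or selected and not
    reached, so the phase ran out of time. *)
Lemma left_phase_busy l j : j \in jobs sigma -> released j l ->
  (l < due_phase j)%N -> j \notin served l.+1 -> (m <= size (newly_served l))%N.
Proof.
rewrite servedS mem_cat negb_or => j_job j_rel j_due /andP[j_served j_new].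
have j_pool : j \in pool l by rewrite mem_pool; apply/and4P.
have [j_sel|] := boolP (j \in selected l); last exact: size_newly_served_full.
have := phase_progress l; rewrite geq_min; case/orP => // sel_new.
have [_ ] := uniq_min_size (newly_served_uniq l) (@newly_served_selected l) sel_new.
by move/(_ j); rewrite j_sel (negbTE j_new).
Qed.

(** If a pending request due by D is not selected, then by EDF the selection is full and all due by
    D. Otherwise what is left and what is served fit together into one selection. *)
Lemma phase_busy_or_few_left l D :
  (m <= count (fun j => due_phase j <= D) (newly_served l) \/
   count (fun j => [&& released j l, l < due_phase j <= D
                     & j \notin served l.+1]) (jobs sigma)
     <= Num.truncn K - m)%N.
Proof.
have [/hasP[j j_pool /andP[jD j_sel]]|/hasPn due_sel] :=
  boolP (has (fun j => (due_phase j <= D)%N && (j \notin selected l)) (pool l)).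
  left; apply: leq_trans (size_newly_served_full j_pool j_sel) _.
  rewrite -(count_predT (newly_served l)).
  rewrite [leqRHS](eq_in_count (a2 := predT)) // => i i_new.
  apply: leq_trans jD; apply: edf_before j_pool j_sel.
  exact: newly_served_selected.
right.
suff : (count (fun j => [&& released j l, l < due_phase j <= D
                     & j \notin served l.+1]) (jobs sigma)
       + size (newly_served l) <= size (selected l))%N.
  have := phase_progress l; have := size_take_min (Num.truncn K) (edf_order c (pool l)).
  have := capacity_le; rewrite -/(selected l); lia.
rewrite -size_filter -size_cat; apply: uniq_leq_size.
  rewrite cat_uniq newly_served_uniq filter_uniq ?jobs_uniq // andbT /=.
  apply/hasPn => j j_new; rewrite mem_filter servedS mem_cat j_new orbT /=.
  by rewrite !andbF.
move=> j; rewrite mem_cat mem_filter => /orP[|/newly_served_selected//].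
rewrite servedS mem_cat negb_or.
case/andP=> /and3P[j_rel /andP[l_due due_D] /andP[j_served _]] j_job.
have j_pool : j \in pool l by rewrite mem_pool; apply/and4P.
by have := due_sel j j_pool; rewrite due_D /= negbK.
Qed.

End Capacity.
End Run.

(** * Numerical estimates and the competitive ratio *)

Lemma OPT_attained (R : realType) (V : finType) (w : V -> V -> R)
    (sigma : seq (request V)) :
  exists2 s, feasible w sigma s & size s = OPT w sigma.
Proof.
rewrite /OPT.
have [|k] := eq_bigmax_cond (A := fun k : 'I_(size sigma).+1 =>
  `[< exists2 s, feasible w sigma s & size s = k >]) (fun k => k : nat).
  (* The empty schedule shows that the maximum ranges over a nonempty set. *)
  by apply/card_gt0P; exists ord0; apply/asboolP; exists [::].
by move=> /asboolP[s fs sk] ->; exists s.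
Qed.

Section Competitiveness.
Variables (R : realType) (V : finType) (w : V -> V -> R) (L : nat).
Variables (c : edf_choices w L) (sigma : seq (request V)).
Hypothesis w_metric : is_metric w.
Hypothesis TSP_ge1 : 1 <= TSP w.
Hypothesis L_large : 10 * TSP w < L%:R.
Hypothesis sigma_valid : valid_input sigma.
Hypothesis sigma_lax : forall j, j \in jobs sigma -> (L <= laxity j)%N.

Let K := phase_length w L.

Lemma phase_length_sqr : K ^+ 2 = TSP w * L%:R.
Proof. by rewrite sqr_sqrtr // mulr_ge0 //; have := TSP_ge1; lra. Qed.

(** The constant 10 enters here, through 10 >= 3 ^ 2. *)
Lemma phase_length_ge : 3 * TSP w <= K.
Proof.
have T1 := TSP_ge1; have T0 : 0 <= 3 * TSP w by lra.
rewrite -(ger0_norm T0) -sqrtr_sqr ler_wsqrtr // expr2.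
have := L_large; have : 0 <= TSP w by lra.
nra.
Qed.

Lemma phase_length_gt0 : 0 < K.
Proof. by have := phase_length_ge; have := TSP_ge1; lra. Qed.

Lemma phase_length_ratio : K * Num.sqrt (TSP w / L%:R) = TSP w.
Proof.
have T1 := TSP_ge1; have LT := L_large.
have L0 : (L%:R : R) != 0 by apply/eqP; lra.
rewrite -sqrtrM; last by rewrite mulr_ge0 //; lra.
have -> : TSP w * L%:R * (TSP w / L%:R) = TSP w ^+ 2 by field.
by rewrite sqrtr_sqr ger0_norm //; lra.
Qed.

Lemma release_laxity j : j \in jobs sigma ->
  (release j)%:R + L%:R <= (deadline j)%:R :> R.
Proof.
move=> js; rewrite -natrD ler_nat.
have := sigma_valid js; have := sigma_lax js; rewrite /laxity; lia.
Qed.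

(** Multiply 3 TSP <= K by L and divide K ^ 2 = TSP L by K. *)
Lemma three_phases_le_laxity : 3 * K <= L%:R.
Proof.
have := phase_length_sqr; have := phase_length_ge; have := phase_length_gt0.
have := TSP_ge1; rewrite expr2; nra.
Qed.

Let m := Num.truncn (K - 2 * TSP w).
(** 90 = 6 * 15: as K <= 6 m, the product [delta * m] is at least 15 TSP. *)
Let delta := 90 * Num.sqrt (TSP w / L%:R).

(** The third TSP absorbs the unit lost by truncation. *)
Lemma capacity_itv : K - 3 * TSP w <= m%:R <= K - 2 * TSP w.
Proof.
have T1 := TSP_ge1; have KT := phase_length_ge.
have /truncn_itv/andP[-> lt_m] : 0 <= K - 2 * TSP w by lra.
by rewrite -/m -addn1 natrD in lt_m; lra.
Qed.

(** Since TSP <= K / 3 and m >= 1, one has 2 m >= m + 1 > K - 2 TSP >= K / 3. *)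
Lemma capacity_ge : K <= 6 * m%:R.
Proof.
have T1 := TSP_ge1; have KT := phase_length_ge.
have : (0 < m)%N by rewrite /m truncn_gt0; lra.
rewrite -(ler_nat R) => m1; have := truncnS_gt (K - 2 * TSP w).
rewrite -/m -natr1.
lra.
Qed.

Lemma OPT_le_tsp_edf :
  (OPT w sigma)%:R <= (1 + delta) * (tsp_edf c sigma)%:R.
Proof.
have [s s_feas <-] := OPT_attained w sigma.
have T1 := TSP_ge1; have KT := phase_length_ge; have K_gt0 := phase_length_gt0.
have KK := phase_length_sqr; have L3 := three_phases_le_laxity.
have mK := capacity_ge; have /andP[m_ge m_le] := capacity_itv.
have delta_ge0 : 0 <= delta by rewrite mulr_ge0 ?sqrtr_ge0.
have deltaK : delta * K = 90 * TSP w.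
  by rewrite /delta -mulrA [_ * K]mulrC phase_length_ratio.
have deltam : 15 * TSP w <= delta * m%:R by nra.
have m_bound : 2 * TSP w + m%:R <= K by lra.
have /andP[X_uniq X_jobs] : uniq [seq p.1 | p <- s]
    && all [in jobs sigma] [seq p.1 | p <- s].
  by case: s_feas => -> sub _ _; apply/allP.
have KM : (Num.truncn K)%:R <= K by rewrite truncn_le ltW.
have carry : (Num.truncn K - m)%:R <= 3 * TSP w.
  by rewrite natrB ?(capacity_le c w_metric K_gt0) //; lra.
suff [N] : exists N, (size [seq p.1 | p <- s])%:R
    <= (1 + delta) * (size (served c sigma N))%:R :> R.
  rewrite size_map => /le_trans; apply; rewrite ler_wpM2l //; first lra.
  by rewrite ler_nat size_served_le_tsp_edf.
(* The subtraction is real: for n = 0 the bound is -K. *)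
have late_release n j :
    ~~ ((0 < n)%N && @released R V w L j n.-1) -> K * (n%:R - 1) <= (release j)%:R.
  case: n => [|n] /=; first by have := ler0n R (release j); lra.
  by rewrite /released -ltNge -addn1 natrD addrK => /ltW.
have due_deadline D j : (due_phase w L j <= D)%N ->
    (deadline j)%:R <= K * (D%:R + 1).
  move=> jD; apply: ltW; apply: lt_le_trans (deadline_lt_due_phase K_gt0 j) _.
  by rewrite ler_pM2l // -natr1 lerD2r ler_nat.
apply: (@phase_competitive R _ (jobs sigma) _ (due_phase w L) (@released R V w L)
          (newly_served c sigma) (served c sigma) m (Num.truncn K - m)) => //.
- exact: servedS.
- exact: served_uniq.
- move=> l j /newly_served_pool.
  by rewrite mem_pool // => /and4P[].
- move=> l j /newly_served_pool.
  by rewrite mem_pool // => /and4P[].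
- exact: phase_busy_or_few_left.
- exact: left_phase_busy.
- exact/allP.
- move=> j js; have jL := release_laxity js.
  have d_gt0 : (0 < due_phase w L j)%N.
    by rewrite le_due_phase // -/K; have := ler0n R (release j); lra.
  rewrite d_gt0 /released -/K.
  have := deadline_lt_due_phase K_gt0 j; rewrite -/K.
  by rewrite -(prednK d_gt0) -!natr1 /=; lra.
- by lra.
move=> n D j nD js /late_release j_rel /due_deadline j_due.
set H : R := D%:R - n%:R.
have jL := release_laxity js; rewrite -addnn !natrD natrM (natrB _ nD) -/H.
have := @feasible_slots _ _ _ w_metric sigma s
  (fun j => ~~ ((0 < n)%N && @released R V w L j n.-1)
            && (due_phase w L j <= D)%N)
  (K * (n%:R - 1)) (K * (D%:R + 1)) s_feas.
rewrite -!mulrBr => slots.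
(* The window of j lies between K (n - 1) and K (D + 1): rounding costs one phase at each end. *)
have L_le : L%:R <= K * (H + 2) by rewrite /H; lra.
have H1 : 1 <= H by rewrite -(ler_pM2l K_gt0); lra.
(* Multiplied by K, this is TSP L <= TSP K (H + 2). *)
have K_le : K <= TSP w * (H + 2) by rewrite -(ler_pM2l K_gt0) mulrCA -expr2 KK ler_wpM2l //; lra.
have {}slots : (count (fun j => ~~ ((0 < n)%N && @released R V w L j n.-1)
    && (due_phase w L j <= D)%N) [seq p.1 | p <- s])%:R <= K * (H + 2).
  rewrite /H; suff -> : K * (D%:R - n%:R + 2) = K * (D%:R + 1 - (n%:R - 1)).
    apply: slots; first by rewrite ler_pM2l //; rewrite /H in H1; lra.
    by move=> i _ /andP[/late_release ? /due_deadline].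
  ring.
(* The excess over m H is at most 3 TSP H for short loads, 2 K <= 2 TSP H + 4 TSP for the two extra
   phases and 6 TSP for the two carries: 15 TSP H in all, as H >= 1. *)
have mH : (K - 3 * TSP w) * H <= m%:R * H by rewrite ler_wpM2r //; lra.
have dmH : 15 * TSP w * H <= delta * m%:R * H by rewrite ler_wpM2r //; lra.
have TH : TSP w <= TSP w * H by rewrite ler_peMr //; lra.
lra.
Qed.

End Competitiveness.

Theorem theorem6 (R : realType) :
  exists C : R, 0 < C /\
    forall (V : finType) (w : V -> V -> R) (L : nat) (c : edf_choices w L),
      is_metric w -> 1 <= TSP w -> 10 * TSP w < L%:R ->
      (competitive_ratio w L (tsp_edf c)
         <= (1 + C * Num.sqrt (TSP w / L%:R))%:E)%E.
Proof.
exists 90; split=> // V w L c w_metric T1 LT.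
apply: ge_ereal_sup => _ [sigma [sigma_valid [_ sigma_lax]] <-].
have := OPT_le_tsp_edf c w_metric T1 LT sigma_valid sigma_lax.
(* If the algorithm serves nothing, the bound forces OPT to be 0, and 0 times +oo is 0. *)
rewrite inver; case: eqP => [->|/eqP ALG0].
  rewrite mulr0 lern0 => /eqP->; rewrite mul0e lee_fin.
  by rewrite addr_ge0 ?mulr_ge0 ?sqrtr_ge0.
by rewrite -EFinM lee_fin ler_pdivrMr // lt_neqAle eq_sym ALG0 /=.
Qed.
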